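(* Let $m$ be a positive integer and $\lambda$ a nonzero real number. For integers $n\ge k\ge0$, $$W_{m,\lambda}(n,k)=\sum_{i=k}^{n}\binom{n}{i}m^{i-k}(1)_{n-i,\lambda}\,S_{2,\lambda/m}(i,k).$$
   Context: For a nonzero real $\mu$: $(x)_{0,\mu}=1$, $(x)_{n,\mu}=x(x-\mu)\cdots(x-(n-1)\mu)$; $(x)_n=(x)_{n,1}$. Degenerate Stirling numbers of the second kind: $(x)_{n,\mu}=\sum_{k=0}^{n}S_{2,\mu}(n,k)(x)_{k}$. Degenerate Whitney numbers of the second kind $W_{m,\lambda}(n,k)$: $(mx+1)_{n,\lambda}=\sum_{k=0}^{n}W_{m,\lambda}(n,k)m^{k}(x)_{k}$. *)

(* Defs.v *)
From HB Require Import structures.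
From mathcomp Require Import all_boot all_order all_algebra.
From mathcomp Require Import ring.
From mathcomp Require Import boolp classical_sets reals.

Set Implicit Arguments.
Unset Strict Implicit.
Unset Printing Implicit Defensive.

Import Order.TTheory GRing.Theory Num.Theory.
Local Open Scope ring_scope.

(* mu = 1 gives the ordinary falling factorial (x)_n. *)
Definition dfall (R : realType) (mu x : R) (n : nat) : R :=
  \prod_(i < n) (x - i%:R * mu).

Notation "x ^_{ n , mu }" := (dfall mu x n)
  (at level 29, n at level 99, mu at level 99, left associativity,
   format "x ^_{ n ,  mu }") : ring_scope.

(* The row c = (S_{2,mu}(n,k))_k; only the entries with k <= n are constrained. *)
Definition is_dstirling2_row (R : realType) (mu : R) (n : nat)
    (c : nat -> R) : Prop :=
  forall x : R, x^_{n, mu} = \sum_(0 <= k < n.+1) c k * x^_{k, 1}.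

Definition is_dwhitney2_row (R : realType) (m : nat) (lambda : R) (n : nat)
    (c : nat -> R) : Prop :=
  forall x : R, (m%:R * x + 1)^_{n, lambda} =
    \sum_(0 <= k < n.+1) c k * m%:R ^+ k * x^_{k, 1}.

(* S_{2,mu}(n,k) and W_{m,lambda}(n,k): entries of the rows given by the        *)
(* defining expansions. Such rows exist (dstirling2P, dwhitney2P) and their     *)
(* entries with k <= n are unique, for W when m > 0 (dstirling2_uniq,           *)
(* dwhitney2_uniq). The entries with k > n are junk values.                     *)
Definition dstirling2 (R : realType) (mu : R) (n k : nat) : R :=
  xget (fun=> 0) [set c | is_dstirling2_row mu n c]%classic k.

Definition dwhitney2 (R : realType) (m : nat) (lambda : R) (n k : nat) : R :=
  xget (fun=> 0) [set c | is_dwhitney2_row m lambda n c]%classic k.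

Lemma dfallS (R : realType) (mu x : R) n :
  x^_{n.+1, mu} = x^_{n, mu} * (x - n%:R * mu).
Proof. by rewrite /dfall big_ord_recr. Qed.

Lemma prod_affine_dfall (R : realType) (a : R) (b : nat -> R) n :
  exists c : nat -> R, forall x : R,
    \prod_(i < n) (a * x + b i) =
    \sum_(0 <= k < n.+1) c k * a ^+ k * x^_{k, 1}.
Proof.
suff [c [_ cE]] : exists c : nat -> R, (forall k, (n < k)%N -> c k = 0) /\
    forall x : R, \prod_(i < n) (a * x + b i) =
      \sum_(0 <= k < n.+1) c k * a ^+ k * x^_{k, 1} by exists c.
elim: n => [|n [c [c0 cE]]].
  exists (fun k => (k == 0%N)%:R); split; first by case.
  by move=> x; rewrite big_nat1 /dfall !big_ord0 expr0 !mulr1.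
exists (fun k => (if k is j.+1 then c j else 0) + (a * k%:R + b n) * c k).
split=> [[|k]// kn|x].
  by rewrite (c0 k) // (c0 k.+1) ?mulr0 ?addr0 // ltnW.
rewrite big_ord_recr /= cE.
under [RHS]eq_bigr do rewrite !mulrDl.
rewrite big_split /= [X in _ = X + _]big_nat_recl //.
rewrite [X in _ = _ + X]big_nat_recr //= (c0 n.+1) //.
rewrite !(mulr0, mul0r) !addr0 add0r.

rewrite -big_split mulr_suml /=; apply: eq_bigr => k _.
rewrite dfallS exprS; ring.
Qed.

Lemma dfall_basis_free (R : realType) n (d : nat -> R) :
  (forall x : R, \sum_(0 <= k < n.+1) d k * x^_{k, 1} = 0) ->
  forall k, (k <= n)%N -> d k = 0.
Proof.
move=> d0; elim/ltn_ind=> k IH kn.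
have := d0 k%:R; rewrite (@big_cat_nat _ _ _ k.+1) //= big_nat_recr //=.
rewrite big_nat big1 ?add0r => [|i /andP[_ ik]]; last first.
  by rewrite IH ?mul0r // (leq_trans (ltnW ik)).
rewrite [X in _ + X]big_nat [X in _ + X]big1 ?addr0 => [|i /andP[ki _]]; last first.
  by rewrite /dfall (bigD1 (Ordinal ki)) //= mulr1 subrr mul0r mulr0.
move/eqP; rewrite mulf_eq0 => /orP[/eqP//|/prodf_eq0[i _]].
by rewrite mulr1 subr_eq0 eqr_nat gtn_eqF.
Qed.

Lemma dwhitney2P (R : realType) m (lambda : R) n :
  is_dwhitney2_row m lambda n (dwhitney2 m lambda n).
Proof.
have [c cE] := prod_affine_dfall m%:R (fun i => 1 - i%:R * lambda) n.
apply: (@xgetPex _ _ [set c | is_dwhitney2_row m lambda n c]%classic).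
by exists c => x; rewrite -cE; apply: eq_bigr => i _; rewrite addrA.
Qed.

Lemma dwhitney2_uniq (R : realType) m (lambda : R) n (c : nat -> R) :
  (0 < m)%N -> is_dwhitney2_row m lambda n c ->
  forall k, (k <= n)%N -> c k = dwhitney2 m lambda n k.
Proof.
move=> m0 cP k kn; apply/eqP; rewrite -subr_eq0.
have : (c k - dwhitney2 m lambda n k) * m%:R ^+ k = 0.
  apply: (@dfall_basis_free R n
    (fun k => (c k - dwhitney2 m lambda n k) * m%:R ^+ k)) => // x.
  under eq_bigr do rewrite !mulrBl.
  by rewrite sumrB -cP -dwhitney2P subrr.
by move/eqP; rewrite mulf_eq0 expf_eq0 pnatr_eq0 -(negbK (m == 0%N)) -lt0n m0
  andbF orbF.
Qed.

Lemma dstirling2P (R : realType) (mu : R) n :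
  is_dstirling2_row mu n (dstirling2 mu n).
Proof.
have [c cE] := prod_affine_dfall 1 (fun i => - (i%:R * mu)) n.
apply: (@xgetPex _ _ [set c | is_dstirling2_row mu n c]%classic).
exists c => x; have := cE x; rewrite mul1r => dE; rewrite /dfall dE.
by apply: eq_bigr => k _; rewrite expr1n mulr1.
Qed.

Lemma dstirling2_uniq (R : realType) (mu : R) n (c : nat -> R) :
  is_dstirling2_row mu n c ->
  forall k, (k <= n)%N -> c k = dstirling2 mu n k.
Proof.
move=> cP k kn; apply/eqP; rewrite -subr_eq0; apply/eqP.
apply: (@dfall_basis_free R n (fun k => c k - dstirling2 mu n k)) => // x.
under eq_bigr do rewrite mulrBl.
by rewrite sumrB -cP -dstirling2P subrr.
Qed.

(* Main.v *)
(* Vandermonde's convolution for degenerate falling factorials expands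
   (m x + 1)_{n,lambda} in the products (m x)_{i,lambda} (1)_{n-i,lambda}, and
   (m x)_{i,lambda} = m^i (x)_{i,lambda/m}; comparing coefficients in the
   basis of falling factorials gives the formula. *)
Require Import Defs.
From mathcomp Require Import all_boot all_order all_algebra.
From mathcomp Require Import ring.
From mathcomp Require Import reals.
Import Order.TTheory GRing.Theory Num.Theory.
Local Open Scope ring_scope.

Lemma dfallD (R : realType) (mu x y : R) n :
  (x + y)^_{n, mu} =
    \sum_(0 <= i < n.+1) 'C(n, i)%:R * x^_{i, mu} * y^_{n - i, mu}.
Proof.
elim: n => [|n IH]; first by rewrite big_nat1 /dfall !big_ord0 bin0 !mulr1.
rewrite dfallS {}IH mulr_suml.
(* The new factor splits as [(x - i mu) + (y - (n - i) mu)], and each part lengthens one of the two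
   falling factorials. *)
transitivity (\sum_(0 <= i < n.+1)
    ('C(n, i)%:R * x^_{i.+1, mu} * y^_{n - i, mu}
     + 'C(n, i)%:R * x^_{i, mu} * y^_{n.+1 - i, mu})).
  apply: eq_big_nat => i /andP[_ lein].
  by rewrite subSn // !dfallS natrB //; ring.
rewrite big_split /= [RHS]big_nat_recl //.
(* Pascal's rule; the top term of the ['C(n, i.+1)] part vanishes. *)
under [X in _ = _ + X]eq_bigr do rewrite binS natrD !mulrDl subSS.
rewrite big_split /= [X in _ = _ + (X + _)]big_nat_recr //= (bin_small (ltnSn n)).
rewrite mulr0n !mul0r addr0 addrA [LHS]addrC; congr (_ + _).
by rewrite big_nat_recl // !bin0.
Qed.

Lemma dfallZ (R : realType) (a mu x : R) n :
  (a * x)^_{n, a * mu} = a ^+ n * x^_{n, mu}.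
Proof.
elim: n => [|n IH]; first by rewrite /dfall !big_ord0 mulr1.
by rewrite !dfallS IH exprS; ring.
Qed.

Theorem theorem13 (R : realType) (m : nat) (lambda : R)
    (m_gt0 : (0 < m)%N) (lambda_neq0 : lambda != 0)
    (n k : nat) (k_le_n : (k <= n)%N) :
  dwhitney2 m lambda n k =
    \sum_(k <= i < n.+1)
      'C(n, i)%:R * m%:R ^+ (i - k) * (1 : R)^_{n - i, lambda}
        * dstirling2 (lambda / m%:R) i k.
Proof.
set F := fun i k : nat => 'C(n, i)%:R * m%:R ^+ (i - k)
  * (1 : R)^_{n - i, lambda} * dstirling2 (lambda / m%:R) i k.
symmetry.
(* By uniqueness of the row, it is enough that these sums satisfy the defining expansion. *)
apply: (@dwhitney2_uniq R m lambda n (fun k => \sum_(k <= i < n.+1) F i k)) => // x.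
have mR0 : (m%:R : R) != 0 by rewrite pnatr_eq0 -lt0n.
have lamE : lambda = m%:R * (lambda / m%:R) by rewrite mulrCA divff ?mulr1.
rewrite dfallD.
(* Turning the bound [k <= i] into a guard makes the range of [i] independent of [k], so the sums
   can be exchanged. *)
under [RHS]eq_bigr do rewrite -mulrA big_distrl /= (@big_nat_widenl _ _ _ _ 0) //=.
rewrite [RHS](@exchange_big_dep_nat _ _ _ _ _ _ _ _ _ predT) //=.
apply: eq_big_nat => i /andP[_ lein].
(* Only the factor in [m x] is rescaled; the one at [1] keeps step [lambda]. *)
rewrite {1}lamE dfallZ dstirling2P !mulr_sumr mulr_suml.
rewrite (@big_nat_widen _ _ _ 0 i.+1 n.+1) //=.
apply: eq_big => [j|j]; rewrite /= ltnS // => leji.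
have -> : (m%:R : R) ^+ i = m%:R ^+ (i - j) * m%:R ^+ j by rewrite -exprD subnK.
by rewrite /F; ring.
Qed.
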